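(* Let $D$ be a diagram of a knot. Then $D$ is homogeneous if and only if $\Delta(D)=0$, where $$\Delta(D)=O(D)+1-O_{+}(D)-O_{-}(D).$$
   Context: Knots are oriented and diagrams are planar. $O(D)$ is the number of Seifert circles of $D$ (the circles obtained by smoothing every crossing along the orientation). $O_{+}(D)$ (respectively $O_{-}(D)$) is the number of connected components (as a subset of the plane) of the diagram obtained from $D$ by smoothing, along the orientation, all negative (respectively all positive) crossings of $D$. The Seifert graph $G(D)$ is the signed graph (each edge labelled $+$ or $-$; multiple edges allowed) with one vertex for each Seifert circle of $D$ and one edge for each crossing of $D$, joining the two vertices corresponding to the two Seifert circles adjacent to the crossing, and labelled by the sign of the crossing. A block of a graph is a maximal connected subgraph having no cut-vertices (of its own). A signed graph is homogeneous if within each block all edges have the same sign. The diagram $D$ is homogeneous if $G(D)$ is homogeneous. *)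

(* Defs.v *)
From mathcomp Require Import all_boot all_order all_algebra.

Set Implicit Arguments.
Unset Strict Implicit.
Unset Printing Implicit Defensive.

(* Connected components of the graph with vertex set A and adjacency e, the
   direction of e being ignored.  They are used only when e-steps stay in A. *)
Definition component (T : finType) (e : rel T) (A : {set T}) (x : T) : {set T} :=
  [set y in A | connect [rel u v | e u v || e v u] x y].

Definition components (T : finType) (e : rel T) (A : {set T}) : {set {set T}} :=
  [set component e A x | x in A].

(** Signed multigraphs *)

(* The order of the pair [ends e] is irrelevant. *)
Record signed_graph := SignedGraph {
  vertex : finType;
  edge : finType;
  ends : edge -> vertex * vertex;
  positive_edge : edge -> bool
}.

Record subgraph (G : signed_graph) := Subgraph {
  sub_vertices : {set vertex G};
  sub_edges : {set edge G};
  sub_edgesP : forall e, e \in sub_edges ->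
    ((ends e).1 \in sub_vertices) && ((ends e).2 \in sub_vertices)
}.

Section Graph.

Variable G : signed_graph.
Implicit Type H : subgraph G.

Definition joins (F : {set edge G}) : rel (vertex G) :=
  [rel u v | [exists e in F, ends e == (u, v)]].

Definition graph_components H : {set {set vertex G}} :=
  components (joins (sub_edges H)) (sub_vertices H).

Definition connected_subgraph H : Prop := #|graph_components H| = 1.

Lemma delete_vertex_subproof H (v : vertex G) (e : edge G) :
  e \in [set e in sub_edges H | ((ends e).1 != v) && ((ends e).2 != v)] ->
  ((ends e).1 \in sub_vertices H :\ v) && ((ends e).2 \in sub_vertices H :\ v).
Proof.
rewrite inE => /and3P[/sub_edgesP/andP[e1 e2] v1 v2].
by rewrite !in_setD1 v1 v2 e1 e2.
Qed.

Definition delete_vertex H (v : vertex G) : subgraph G :=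
  Subgraph (@delete_vertex_subproof H v).

Definition cut_vertex H (v : vertex G) : Prop :=
  v \in sub_vertices H /\
  #|graph_components H| < #|graph_components (delete_vertex H v)|.

Definition nonseparable H : Prop :=
  connected_subgraph H /\ forall v, ~ cut_vertex H v.

Definition subgraph_le H K : Prop :=
  sub_vertices H \subset sub_vertices K /\ sub_edges H \subset sub_edges K.

Definition block H : Prop :=
  nonseparable H /\
  forall K, nonseparable K -> subgraph_le H K -> subgraph_le K H.

Definition homogeneous_graph : Prop :=
  forall H, block H ->
    {in sub_edges H &, forall e f, positive_edge e = positive_edge f}.

End Graph.

(** Oriented planar knot diagrams *)

(* Turn each crossing x so that both strands point upwards.  The strand
   (x, true) then runs from bottom left to top right and (x, false) from bottom
   right to top left; [inarc] and [outarc] give the arcs of the underlying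
   4-valent plane graph by which a strand enters and leaves the crossing:

       outarc (x, false)   outarc (x, true)
                        \ /
                         x
                        / \
        inarc (x, true)     inarc (x, false)

   The same picture describes the crossingless diagram, which has no crossing
   and a single closed arc. *)

Definition goes_straight (X A : finType) (inarc outarc : X * bool -> A) : rel A :=
  [rel a b | [exists p, (inarc p == a) && (outarc p == b)]].

(* A pair (a, true) (resp. (a, false)) is the left (resp. right) side of the
   oriented arc a.  Two sides are related when they bound the same of the four
   corners (left, bottom, top, right) at some crossing. *)
Definition same_corner (X A : finType) (inarc outarc : X * bool -> A) :
    rel (A * bool) :=
  [rel s t | [exists x,
    [|| (s == (inarc (x, true), true)) && (t == (outarc (x, false), true)),
        (s == (inarc (x, true), false)) && (t == (inarc (x, false), true)),
        (s == (outarc (x, false), false)) && (t == (outarc (x, true), true))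
      | (s == (inarc (x, false), false)) && (t == (outarc (x, true), false))]]].

(* - Knot: following the orientation straight through the crossings leads from
     every arc to every arc.  With injectivity this makes [inarc] and [outarc]
     bijective, unless there is no crossing and just one arc.
   - Planarity: there are F = V + 2 faces.  If there are V > 0 crossings there
     are 2V arcs, so this is Euler's formula V - 2V + F = 2; the crossingless
     circle has the two faces given by the two sides of its arc. *)
Record knot_diagram := KnotDiagram {
  crossing : finType;
  arc : finType;
  inarc : crossing * bool -> arc;
  outarc : crossing * bool -> arc;
  over_strand : crossing -> bool;
  inarc_inj : injective inarc;
  outarc_inj : injective outarc;
  arc_nonempty : 0 < #|arc|;
  single_strand : forall a b : arc, connect (goes_straight inarc outarc) a b;
  planar : #|components (same_corner inarc outarc) [set: arc * bool]|
           = #|crossing| + 2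
}.

Section Diagram.

Variable D : knot_diagram.

(* When the over-strand runs from bottom left to top right, it is turned
   counterclockwise onto the under-strand: the crossing is positive. *)
Definition positive (x : crossing D) : bool := over_strand x.
Definition negative (x : crossing D) : bool := ~~ positive x.

Definition arcs_at (x : crossing D) : {set arc D} :=
  [set inarc (x, true); inarc (x, false); outarc (x, true); outarc (x, false)].

(* The arcs which touch at a crossing after the crossings in S are smoothed:
   the smoothing lets each incoming arc continue in the outgoing arc of the
   other strand, while all four arcs meet at a crossing that is kept. *)
Definition touch (S : pred (crossing D)) : rel (arc D) :=
  [rel a b | [exists x,
    if S x then [exists s : bool, (inarc (x, s) == a) && (outarc (x, ~~ s) == b)]
    else (a \in arcs_at x) && (b \in arcs_at x)]].

(* The components of the smoothed diagram, each given by its set of arcs. *)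
Definition smoothed_components (S : pred (crossing D)) : {set {set arc D}} :=
  components (touch S) [set: arc D].

Definition seifert_circles : {set {set arc D}} := smoothed_components predT.

Definition O_all : nat := #|seifert_circles|.
Definition O_plus : nat := #|smoothed_components negative|.
Definition O_minus : nat := #|smoothed_components positive|.

Definition Delta : int := (O_all%:Z + 1 - O_plus%:Z - O_minus%:Z)%R.

Definition seifert_circle : finType := {C : {set arc D} | C \in seifert_circles}.

Lemma circle_of_subproof (a : arc D) :
  component (touch predT) [set: arc D] a \in seifert_circles.
Proof. exact: imset_f. Qed.

Definition circle_of (a : arc D) : seifert_circle :=
  exist _ (component (touch predT) [set: arc D] a) (circle_of_subproof a).

(* Each strand of the smoothed crossing contains one of the incoming arcs. *)
Definition seifert_graph : signed_graph :=
  @SignedGraph seifert_circle (crossing D)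
    (fun x => (circle_of (inarc (x, true)), circle_of (inarc (x, false))))
    positive.

Definition homogeneous : Prop := homogeneous_graph seifert_graph.

End Diagram.

(* Main.v *)
(* Let G be the Seifert graph and U+ (resp. U-) the space of rational functions
   on its vertices which are constant along positive (resp. negative) edges.
   Then dim U+ = O_+, dim U- = O_-, and the intersection of U+ and U- consists
   of the constants since G is connected.
   Hence Delta = 0 if and only if every function is a sum p + n with p in U+
   and n in U-.

   If the indicator of a vertex v is such a sum, then p = - n is constant on each
   component of G - v, so v cannot be joined to one component by edges of both
   signs; this forbids two signs in a nonseparable subgraph.  Conversely, two
   edges from v to the same component of G - v lie on a cycle, hence in a block.
   So in a homogeneous graph the edges from v to any component K of G - v have
   the same sign, and p can be taken to be the indicator of v and of the K
   attached positively.

   This needs G to be loopless: loops of both signs at a vertex make a graph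
   inhomogeneous without changing Delta.  Here planarity comes in: by Euler's
   formula every rational 1-cycle z of the diagram is the jump
   f(left) - f(right) of a function f on the faces.
   For z a Seifert circle, f is constant along the left side of the circle.  If
   the circle met itself at a crossing, f would take the same value in the left
   and bottom corners, which are separated by an arc of the circle. *)

From mathcomp Require Import all_boot all_order all_algebra ring.
(* Defs comes last: its arc is otherwise shadowed by path.arc. *)
Require Import Defs.

Set Implicit Arguments.
Unset Strict Implicit.
Unset Printing Implicit Defensive.

Import GRing.Theory.
Local Open Scope ring_scope.

(** * Components and the functions constant on them *)

Notation sym_rel e := [rel u v | e u v || e v u].

Definition invariant_fun (T : finType) (X : Type) (e : rel T) (f : T -> X) :=
  forall x y, e x y -> f x = f y.

Lemma connect_invariant (T : finType) (X : Type) (e : rel T) (f : T -> X) :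
  invariant_fun e f -> invariant_fun (connect e) f.
Proof.
move=> ef x y /connectP[p + ->]; elim: p x => //= z p IHp x /andP[/ef -> /IHp].
by [].
Qed.

Lemma invariant_sym (T : finType) (X : Type) (e : rel T) (f : T -> X) :
  invariant_fun e f -> invariant_fun (sym_rel e) f.
Proof. by move=> ef x y /orP[/ef | /ef]. Qed.

Section Components.

Variables (T : finType) (e : rel T).

Lemma sym_connectC : connect_sym (sym_rel e).
Proof. by apply: sym_connect_sym => x y /=; rewrite orbC. Qed.

Lemma mem_component (A : {set T}) x : x \in A -> x \in component e A x.
Proof. by move=> Ax; rewrite inE Ax connect0. Qed.

Lemma eq_component (A : {set T}) x y :
  x \in A -> (component e A x == component e A y) = connect (sym_rel e) x y.
Proof.
move=> Ax; apply/eqP/idP => [exy | cxy].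
  by move: (mem_component Ax); rewrite exy inE Ax sym_connectC.
by apply/setP=> z; rewrite !inE (same_connect sym_connectC cxy).
Qed.

Lemma card_components_le1 (A : {set T}) :
  reflect {in A &, forall x y, connect (sym_rel e) x y}
          (#|components e A| <= 1)%N.
Proof.
apply: (iffP card_le1_eqP) => [eqA x y Ax Ay | cA].
  by rewrite -(eq_component _ Ax); apply/eqP/eqA; apply: imset_f.
move=> _ _ /imsetP[x Ax ->] /imsetP[y Ay ->].
by apply/eqP; rewrite eq_component ?cA.
Qed.

Definition row_of (f : T -> rat) : 'rV[rat]_#|T| := \row_j f (enum_val j).

Lemma row_of_rank f x : row_of f 0 (enum_rank x) = f x.
Proof. by rewrite mxE enum_rankK. Qed.

Lemma row_ofK (u : 'rV[rat]_#|T|) : row_of (fun x => u 0 (enum_rank x)) = u.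
Proof. by apply/rowP=> j; rewrite mxE enum_valK. Qed.

(** Its rows are the indicators of the components, a basis of the invariant rational functions. *)
Definition component_mx : 'M[rat]_(#|components e setT|, #|T|) :=
  \matrix_(i < #|components e setT|, j < #|T|)
    (enum_val j \in (enum_val i : {set T}))%:R.

Lemma component_in x : component e setT x \in components e setT.
Proof. exact: imset_f. Qed.

Definition component_rank x : 'I_#|components e setT| :=
  enum_rank_in (component_in x) (component e setT x).

Lemma mem_component_rank x (i : 'I_#|components e setT|) :
  (x \in (enum_val i : {set T})) = (i == component_rank x).
Proof.
rewrite -(inj_eq enum_val_inj) enum_rankK_in ?component_in //.
have /imsetP[y _ ->] := enum_valP i.
by rewrite eq_component // inE in_setT.
Qed.

Lemma mul_component_mx (u : 'rV_#|components e setT|) x :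
  (u *m component_mx) 0 (enum_rank x) = u 0 (component_rank x).
Proof.
rewrite mxE (bigD1 (component_rank x)) //= mxE enum_rankK mem_component_rank.
rewrite eqxx mulr1 big1 ?addr0 // => i /negPf ix.
by rewrite mxE enum_rankK mem_component_rank ix mulr0.
Qed.

Lemma component_rank_surj i : exists x, component_rank x = i.
Proof.
have /imsetP[x _ ix] := enum_valP i; exists x; apply/esym/eqP.
by rewrite -mem_component_rank ix mem_component ?in_setT.
Qed.

Lemma rank_component_mx : \rank component_mx = #|components e setT|.
Proof.
apply/eqP/inj_row_free => u u0; apply/rowP=> i; have [x <-] := component_rank_surj i.
by rewrite -mul_component_mx u0 !mxE.
Qed.

Lemma component_mxP (f : T -> rat) :
  reflect (invariant_fun e f) (row_of f <= component_mx)%MS.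
Proof.
apply: (iffP submxP) => [[u uf] x y exy | ef].
  rewrite -!row_of_rank uf !mul_component_mx; congr (u 0 _).
  apply/eqP; rewrite -mem_component_rank enum_rankK_in ?component_in //.
  by rewrite inE in_setT connect1 //= exy.
(* The coefficient of a component is the value of [f] at any of its points. *)
exists (\row_i if [pick x in (enum_val i : {set T})] is Some x then f x else 0).
apply/rowP=> j; rewrite -(enum_valK j) row_of_rank mul_component_mx mxE.
case: pickP => [x | /(_ (enum_val j))]; rewrite mem_component_rank ?eqxx //.
move/eqP=> rxy; have := eqxx (component_rank x); rewrite -{1}rxy.
rewrite -mem_component_rank enum_rankK_in ?component_in // inE in_setT /=.
by apply: (connect_invariant (invariant_sym _)).
Qed.

End Components.

Lemma submx_invariant (T : finType) m (A : 'M[rat]_(m, #|T|)) (r : rel T) :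
  (forall f, (row_of f <= A)%MS -> invariant_fun r f) -> (A <= component_mx r)%MS.
Proof.
move=> Ar; apply/row_subP=> i; rewrite -[row i A]row_ofK; apply/component_mxP/Ar.
by rewrite row_ofK row_sub.
Qed.

(** Every row is a multiple of the all-ones row. *)
Lemma rank_const_functions (T : finType) m (A : 'M[rat]_(m, #|T|)) :
  (forall f, (row_of f <= A)%MS -> forall x y, f x = f y) -> (\rank A <= 1)%N.
Proof.
move=> Ac; apply: leq_trans (rank_leq_row (const_mx 1 : 'rV[rat]_#|T|)).
apply/mxrankS/row_subP=> i; have: (row i A <= A)%MS by apply: row_sub.
rewrite -[row i A]row_ofK; move: (fun x => _) => f /Ac fc.
have [x _ | T0] := pickP T; last first.
  suff -> : row_of f = 0 by apply: sub0mx.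
  by apply/rowP=> j; have := T0 (enum_val j).
apply/submxP; exists (f x)%:M; apply/rowP=> j.
by rewrite mul_scalar_mx !mxE mulr1.
Qed.

(** * Counting components by dimensions *)

Section Splitting.

Variables (T : finType) (e e1 e2 : rel T).
Hypothesis e1_inv : forall f : T -> rat, invariant_fun e1 f -> invariant_fun e f.
Hypothesis e2_inv : forall f : T -> rat, invariant_fun e2 f -> invariant_fun e f.
Hypothesis e12_const : forall f : T -> rat,
  invariant_fun e1 f -> invariant_fun e2 f -> forall x y, f x = f y.

Let U := component_mx e.
Let U1 := component_mx e1.
Let U2 := component_mx e2.

(** [U1] and [U2] lie in [U] and meet in the line of constants, so the dimension of [U1 + U2] is one
    less than the sum of theirs. The equation of cardinals thus says that [U1 + U2] is all of
    [U]. *)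
Lemma card_components_split : (0 < #|T|)%N ->
  (#|components e1 setT| + #|components e2 setT| = #|components e setT| + 1)%N <->
  (forall f : T -> rat, invariant_fun e f -> exists p n : T -> rat,
     [/\ invariant_fun e1 p, invariant_fun e2 n & forall x, f x = p x + n x]).
Proof.
move=> T_gt0; rewrite -(rank_component_mx e) -(rank_component_mx e1).
rewrite -(rank_component_mx e2) -/U -/U1 -/U2.
have cap1 : \rank (U1 :&: U2) = 1%N.
  apply/eqP; rewrite eqn_leq rank_const_functions /=; last first.
    move=> f; rewrite sub_capmx => /andP[/component_mxP f1 /component_mxP].
    exact: e12_const.
  rewrite lt0n mxrank_eq0; have [x _] := card_gt0P T_gt0.
  have : (row_of (fun _ : T => 1%R) <= U1 :&: U2)%MS.
    by rewrite sub_capmx; apply/andP; split; apply/component_mxP.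
  apply: contraTneq => ->; rewrite submx0; apply/eqP => /rowP/(_ (enum_rank x)) /eqP.
  by rewrite !mxE oner_eq0.
have sU1 : (U1 <= U)%MS by apply: submx_invariant => f /component_mxP/e1_inv.
have sU2 : (U2 <= U)%MS by apply: submx_invariant => f /component_mxP/e2_inv.
have sU12 : (U1 + U2 <= U)%MS by rewrite addsmx_sub sU1.
rewrite -(mxrank_sum_cap U1 U2) cap1; split.
  move/addIn => /eqP; rewrite eqn_leq => /andP[_ rkU] f /component_mxP.
  have : (U <= U1 + U2)%MS by rewrite -(geq_leqif (mxrank_leqif_sup sU12)).
  move=> UU12 /submx_trans /(_ UU12) /sub_addsmxP[[u1 u2] /= fu].
  exists (fun x => (u1 *m U1) 0 (enum_rank x)), (fun x => (u2 *m U2) 0 (enum_rank x)).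
  split=> [||x]; try by apply/component_mxP; rewrite row_ofK submxMl.
  by rewrite -row_of_rank fu mxE.
move=> split_f; congr (_ + _)%N; apply/eqP; rewrite eqn_leq mxrankS //=.
apply/mxrankS/row_subP=> i; have: (row i U <= U)%MS by apply: row_sub.
rewrite -[row i U]row_ofK; move: (fun x => _) => f /component_mxP/split_f.
case=> p [n [p1 n2 fpn]].
have -> : row_of f = row_of p + row_of n by apply/rowP=> j; rewrite !mxE.
apply: addmx_sub; first by apply: submx_trans (addsmxSl _ _); apply/component_mxP.
by apply: submx_trans (addsmxSr _ _); apply/component_mxP.
Qed.

End Splitting.

(** * Rational matrices indexed by finite types *)

Definition matrix_of (S T : finType) (K : S -> T -> rat) : 'M[rat]_(#|S|, #|T|) :=
  \matrix_(i, j) K (enum_val i) (enum_val j).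

Lemma mul_row_of (S T : finType) (f : S -> rat) (K : S -> T -> rat) :
  row_of f *m matrix_of K = row_of (fun y => \sum_x f x * K x y).
Proof.
apply/rowP=> j; rewrite !mxE.
under eq_bigr do rewrite !mxE.
by rewrite -(big_enum_val (fun x => f x * K x (enum_val j))).
Qed.

Lemma tr_matrix_of (S T : finType) (K : S -> T -> rat) :
  (matrix_of K)^T = matrix_of (fun y x => K x y).
Proof. by apply/matrixP=> i j; rewrite !mxE. Qed.

Lemma row_of_inj (T : finType) (f g : T -> rat) : row_of f = row_of g -> f =1 g.
Proof. by move=> fg x; rewrite -(row_of_rank f) fg row_of_rank. Qed.

Lemma sum_delta (T : finType) (f : T -> rat) (y : T) :
  \sum_x f x * (x == y)%:R = f y.
Proof.
rewrite (bigD1 y) //= eqxx mulr1 big1 ?addr0 // => x /negPf->.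
by rewrite mulr0.
Qed.

(** * Planar diagrams have loopless Seifert graphs *)

Section Planarity.

Variable D : knot_diagram.

Local Notation corner := (same_corner (@inarc D) (@outarc D)).

Lemma corner_invariantP (f : arc D * bool -> rat) :
  invariant_fun corner f <-> forall x,
  [/\ f (inarc (x, true), true) = f (outarc (x, false), true),
      f (inarc (x, true), false) = f (inarc (x, false), true),
      f (outarc (x, false), false) = f (outarc (x, true), true)
    & f (inarc (x, false), false) = f (outarc (x, true), false)].
Proof.
split=> [fc x | fc s t /existsP[x]].
  by split; apply: fc; apply/existsP; exists x; rewrite !eqxx ?orbT.
by case: (fc x) => f1 f2 f3 f4; case/or4P => /andP[/eqP-> /eqP->].
Qed.

Lemma arc_invariant_const (f : arc D -> rat) :
  (forall p, f (inarc p) = f (outarc p)) -> forall a b, f a = f b.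
Proof.
move=> fio a b; apply: (connect_invariant _ (single_strand a b)).
by move=> c d /existsP[p /andP[/eqP <- /eqP <-]].
Qed.

(** * Cycles and faces of a diagram with a crossing *)

Section Crossing.

Variable x0 : crossing D.

(** A straight path to [a] from another arc ends with a step leaving a crossing by [a]. The crossing
    [x0] supplies a starting arc and excludes the crossingless circle. *)
Lemma outarc_surj (a : arc D) : exists p, outarc p = a.
Proof.
have last_step b : b != a -> exists p, outarc p = a.
  move=> ba; have /connectP[p] := single_strand b a.
  case/lastP: p => [_ ab | p c]; first by rewrite ab eqxx in ba.
  rewrite rcons_path last_rcons => /andP[_ /existsP[q /andP[_ /eqP qc]]] ->.
  by exists q.
have [<- | ] := eqVneq (outarc (x0, true)) a; first by exists (x0, true).
exact: last_step.
Qed.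

Lemma outarc_bij : bijective (@outarc D).
Proof.
have fin_inv (a : arc D) : {p : crossing D * bool | outarc p == a}.
  by apply: sigW; have [p <-] := outarc_surj a; exists p.
exists (fun a => sval (fin_inv a)) => [p | a]; last by case: (fin_inv a) => p /= /eqP.
by apply: outarc_inj; case: (fin_inv _) => q /= /eqP.
Qed.

Lemma card_arc : #|arc D| = (#|crossing D| * 2)%N.
Proof. by rewrite -(bij_eq_card outarc_bij) card_prod card_bool. Qed.

Lemma inarc_bij : bijective (@inarc D).
Proof.
by apply: inj_card_bij (@inarc_inj D) _; rewrite card_prod card_bool card_arc.
Qed.

Let jump_mx := matrix_of (fun (s : arc D * bool) (a : arc D) =>
  (s == (a, true))%:R - (s == (a, false))%:R).

(** The boundary map of the 4-valent graph, incoming minus outgoing flow at each crossing; its left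
    kernel is the cycle space. *)
Let boundary_mx := matrix_of (fun (a : arc D) (x : crossing D) =>
  \sum_s ((a == inarc (x, s))%:R - (a == outarc (x, s))%:R)).

Lemma mul_jump_mx (f : arc D * bool -> rat) :
  row_of f *m jump_mx = row_of (fun a => f (a, true) - f (a, false)).
Proof.
rewrite mul_row_of; apply/rowP=> j; rewrite !mxE.
under eq_bigr do rewrite mulrBr.
by rewrite sumrB !sum_delta.
Qed.

Lemma mul_boundary_mx (z : arc D -> rat) :
  row_of z *m boundary_mx =
  row_of (fun x => \sum_s (z (inarc (x, s)) - z (outarc (x, s)))).
Proof.
rewrite mul_row_of; apply/rowP=> j; rewrite !mxE.
under eq_bigr do rewrite mulr_sumr.
rewrite exchange_big /=; apply: eq_bigr => s _.
under eq_bigr do rewrite mulrBr.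
by rewrite sumrB !sum_delta.
Qed.

(** The transpose is the coboundary: the arc [inarc p] runs from the crossing [q.1] to the crossing
    [p.1]. *)
Lemma mul_tr_boundary_mx (g : crossing D -> rat) p q :
  inarc p = outarc q ->
  (row_of g *m boundary_mx^T) 0 (enum_rank (inarc p)) = g p.1 - g q.1.
Proof.
move=> pq; rewrite tr_matrix_of mul_row_of row_of_rank.
under eq_bigr do rewrite mulr_sumr.
rewrite pair_bigA /=.
under eq_bigr => i _ do rewrite -surjective_pairing mulrBr {2}pq.
rewrite sumrB; under eq_bigr do rewrite (inj_eq (@inarc_inj D)) eq_sym.
rewrite sum_delta; congr (_ - _).
by under eq_bigr do rewrite (inj_eq (@outarc_inj D)) eq_sym; rewrite sum_delta.
Qed.

(** A function killed by the coboundary agrees at both ends of every arc, hence is constant, since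
    the knot is a single strand. *)
Lemma rank_boundary_mx : (#|crossing D| <= (\rank boundary_mx).+1)%N.
Proof.
have : (\rank (kermx boundary_mx^T) <= 1)%N.
  apply: rank_const_functions => g /sub_kermxP g0 x y.
  have [head inK Kin] := inarc_bij.
  have hc : forall p, (head (inarc p)).1 = p.1 by move=> p; rewrite inK.
  rewrite -[x](hc (x, true)) -[y](hc (y, true)).
  apply: (@arc_invariant_const (fun a => g (head a).1)) => q.
  rewrite inK; have := mul_tr_boundary_mx g (Kin (outarc q)).
  by rewrite g0 mxE => /esym/eqP; rewrite subr_eq0 => /eqP.
by rewrite mxrank_ker mxrank_tr leq_subLR addn1.
Qed.

Lemma planar_potential (z : arc D -> rat) :
  (forall x, z (inarc (x, true)) + z (inarc (x, false)) =
             z (outarc (x, true)) + z (outarc (x, false))) ->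
  exists2 f : arc D * bool -> rat,
    invariant_fun corner f & forall a, z a = f (a, true) - f (a, false).
Proof.
move=> z_bal; pose B := component_mx corner *m jump_mx.
(* At each crossing the corner values cancel in pairs, so a jump is a cycle. *)
have BE (f : arc D * bool -> rat) x : invariant_fun corner f ->
    \sum_s (f (inarc (x, s), true) - f (inarc (x, s), false) -
            (f (outarc (x, s), true) - f (outarc (x, s), false))) = 0.
  move/corner_invariantP => /(_ x)[f1 f2 f3 f4].
  by rewrite big_bool /= f1 f2 f3 f4; ring.
have sB : (B <= kermx boundary_mx)%MS.
  apply/sub_kermxP/row_matrixP=> i; rewrite row0 /B -!mulmxA row_mul.
  have : (row i (component_mx corner) <= component_mx corner)%MS by apply: row_sub.
  rewrite -[row i _]row_ofK; move: (fun x => _) => f /component_mxP fc.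
  rewrite mulmxA mul_jump_mx mul_boundary_mx; apply/rowP=> j; rewrite !mxE.
  exact: BE.
have rkB : (#|crossing D|.+1 <= \rank B)%N.
  have := mxrank_mul_ker (component_mx corner) jump_mx.
  rewrite -/B => rkE.
  have rkC : \rank (component_mx corner) = (#|crossing D| + 2)%N.
    by rewrite rank_component_mx planar.
  (* Face functions without jumps are constant: passing from corner to corner, each strand keeps its
     value through a crossing. *)
  suff : (\rank (component_mx corner :&: kermx jump_mx) <= 1)%N.
    by rewrite -(leq_add2l (\rank B)) rkE rkC addn1 addn2.
  apply: rank_const_functions => f; rewrite sub_capmx.
  case/andP=> /component_mxP/corner_invariantP fc /sub_kermxP.
  rewrite mul_jump_mx => f0.
  have flr a : f (a, true) = f (a, false).
    apply/eqP; rewrite -subr_eq0; apply/eqP.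
    by have /rowP/(_ (enum_rank a)) := f0; rewrite row_of_rank mxE.
  have fl a b : f (a, true) = f (b, true).
    apply: (@arc_invariant_const (fun a => f (a, true))) => -[x s].
    case: (fc x) => f1 f2 f3 f4; case: s.
      by rewrite f1 flr f3.
    by rewrite flr f4 -flr -f3 flr.
  by move=> [a []] [b []]; rewrite -?flr; apply: fl.
(* With V crossings, the cycle space has dimension at most 2V - (V - 1), while
   the boundaries of the V + 2 faces span a space of dimension V + 1. *)
have KB : (kermx boundary_mx <= B)%MS.
  rewrite -(geq_leqif (mxrank_leqif_sup sB)) mxrank_ker.
  apply: leq_trans rkB; rewrite leq_subLR addnS -addSn.
  by rewrite [X in (X <= _)%N]card_arc muln2 -addnn leq_add2r rank_boundary_mx.
have : (row_of z <= B)%MS.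
  apply: submx_trans KB; apply/sub_kermxP; rewrite mul_boundary_mx.
  apply/rowP=> j; rewrite !mxE sumrB !big_bool /=; apply/eqP.
  by rewrite subr_eq0 z_bal.
case/submxP=> u zu; pose f s := (u *m component_mx corner) 0 (enum_rank s).
have fK : row_of f = u *m component_mx corner by rewrite row_ofK.
exists f; first by apply/component_mxP; rewrite fK submxMl.
by apply: row_of_inj; rewrite -mul_jump_mx fK -mulmxA.
Qed.

End Crossing.

(** * Seifert circles do not meet themselves *)

Lemma touch_predT_invariantP (X : Type) (f : arc D -> X) :
  invariant_fun (@touch D predT) f <->
  forall x s, f (inarc (x, s)) = f (outarc (x, ~~ s)).
Proof.
split=> [ft x s | ft a b /existsP[x /existsP[s /andP[/eqP<- /eqP<-]]] //].
apply: ft; apply/existsP; exists x; apply/existsP; exists s.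
by rewrite !eqxx.
Qed.

Lemma circle_of_eq (a b : arc D) :
  (circle_of a == circle_of b) = connect (sym_rel (@touch D predT)) a b.
Proof. by rewrite -val_eqE /= eq_component ?in_setT. Qed.

Lemma circle_of_invariant : invariant_fun (@touch D predT) (@circle_of D).
Proof. by move=> a b ab; apply/eqP; rewrite circle_of_eq connect1 //= ab. Qed.

Lemma seifert_graph_loopless (x : crossing D) :
  circle_of (inarc (x, true)) != circle_of (inarc (x, false)).
Proof.
apply/negP=> /[dup] /eqP loop; rewrite circle_of_eq => cx.
pose C a := circle_of a == circle_of (inarc (x, true)).
have C_inv : invariant_fun (@touch D predT) C.
  by move=> a b /circle_of_invariant ab; rewrite /C ab.
have [|f /corner_invariantP fc zf] := @planar_potential x (fun a => (C a)%:R).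
  move/touch_predT_invariantP: C_inv => CP y.
  by rewrite (CP y true) (CP y false) addrC.
(* This is [f] on the left of the circle, extended by 0 to the other arcs so that invariance under
   smoothing makes sense. *)
pose h a := if C a then f (a, true) else 0.
have h_inv : invariant_fun (@touch D predT) h.
  apply/touch_predT_invariantP=> y s; rewrite /h.
  have Cy := (touch_predT_invariantP C).1 C_inv y s; rewrite -Cy.
  case: ifP => // Cin; have [f1 _ _ f4] := fc y.
  case: s Cy Cin => /= Cy Cin; first by [].
  (* Here the circle passes the right corner, where the right-hand values agree by [f4]; equal jumps
     then give equal left-hand values. *)
  have := zf (inarc (y, false)); rewrite Cy zf f4.
  by move/addIr.
have := connect_invariant (invariant_sym h_inv) cx.
rewrite /h /C -loop eqxx => fE; have := zf (inarc (x, true)).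
have [_ -> _ _] := fc x.
by rewrite fE subrr /C eqxx => /eqP; rewrite oner_eq0.
Qed.

End Planarity.

(** * Homogeneous signed graphs *)

Section SignedGraph.

Variable G : signed_graph.
Hypothesis loopless : forall e : edge G, (ends e).1 != (ends e).2.
Implicit Types (H K : subgraph G) (u v w x y z : vertex G) (e f : edge G).

Definition links e : rel (vertex G) :=
  [rel u v | (ends e == (u, v)) || (ends e == (v, u))].

Lemma linksC e : symmetric (links e).
Proof. by move=> u v; apply: orbC. Qed.

Lemma links_ends e : links e (ends e).1 (ends e).2.
Proof. by rewrite /links /= -surjective_pairing eqxx. Qed.

Lemma links_neq e u v : links e u v -> u != v.
Proof.
have := loopless e.
by rewrite /links /=; case: (ends e) => a b /= ab /orP[] /eqP[<- <-] //; rewrite eq_sym.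
Qed.

Lemma links_in_subgraph H e u v :
  e \in sub_edges H -> links e u v ->
  (u \in sub_vertices H) && (v \in sub_vertices H).
Proof.
by move=> /sub_edgesP + /orP[] /eqP eE; rewrite eE //= andbC.
Qed.

Lemma links_const (X : Type) (f : vertex G -> X) e u v :
  f (ends e).1 = f (ends e).2 -> links e u v -> f u = f v.
Proof. by move=> fe /orP[] /eqP eE; move: fe; rewrite eE. Qed.

Lemma joins_invariant (X : Type) (F : {set edge G}) (f : vertex G -> X) :
  {in F, forall e, f (ends e).1 = f (ends e).2} -> invariant_fun (joins F) f.
Proof. by move=> fF u v /exists_inP[e /fF] => + /eqP eE; rewrite eE. Qed.

Lemma sym_joins (F : {set edge G}) e u v :
  e \in F -> links e u v -> sym_rel (joins F) u v.
Proof.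
by move=> Fe /orP[] euv; apply/orP; [left | right]; apply/exists_inP; exists e.
Qed.

Lemma nonseparable_connected H :
  nonseparable H ->
  {in sub_vertices H &, forall u v, connect (sym_rel (joins (sub_edges H))) u v}.
Proof. by case=> Hc _; apply/card_components_le1; rewrite [X in (X <= _)%N]Hc. Qed.

Lemma nonseparable_delete_connected H v :
  nonseparable H -> v \in sub_vertices H ->
  {in sub_vertices H :\ v &, forall x y,
    connect (sym_rel (joins (sub_edges (delete_vertex H v)))) x y}.
Proof.
case=> Hc Hcut Hv; apply/card_components_le1; rewrite leqNgt; apply/negP=> lt1.
by apply: (Hcut v); split; rewrite // [X in (X < _)%N]Hc.
Qed.

Definition incident H (s : bool) v :=
  [exists e in sub_edges H, (positive_edge e == s) && [exists u, links e v u]].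

(** Otherwise being incident to a positive edge of [H] would be constant along the edges of [H],
    hence on the connected [H]. *)
Lemma mixed_vertex H e f :
  nonseparable H -> e \in sub_edges H -> f \in sub_edges H ->
  positive_edge e -> ~~ positive_edge f ->
  exists v, incident H true v && incident H false v.
Proof.
move=> Hns He Hf e_pos f_neg; apply/existsP; apply: contraT.
rewrite negb_exists => /forallP unmixed.
have inc g : g \in sub_edges H ->
    incident H (positive_edge g) (ends g).1 /\ incident H (positive_edge g) (ends g).2.
  move=> Hg; split; apply/exists_inP; exists g; rewrite // eqxx /=; apply/existsP.
    by exists (ends g).2; apply: links_ends.
  by exists (ends g).1; rewrite linksC links_ends.
have inv : invariant_fun (joins (sub_edges H)) (incident H true).
  apply: joins_invariant => g /inc[]; case: (positive_edge g) => [-> -> // |].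
  move: (unmixed (ends g).1) (unmixed (ends g).2).
  by do 2![case: (incident H true _) => /= [/negPf -> // | _]].
have /andP[He1 _] := sub_edgesP He; have /andP[Hf1 _] := sub_edgesP Hf.
have := connect_invariant (invariant_sym inv) (nonseparable_connected Hns He1 Hf1).
have [+ _] := inc e He; have [+ _] := inc f Hf.
rewrite e_pos (negPf f_neg) => f1 -> e1.
by have := unmixed (ends f).1; rewrite f1 -e1.
Qed.

(** * Splitting of functions forces homogeneity *)

Definition splits :=
  forall g : vertex G -> rat, exists p n : vertex G -> rat,
  [/\ forall e, positive_edge e -> p (ends e).1 = p (ends e).2,
      forall e, ~~ positive_edge e -> n (ends e).1 = n (ends e).2
    & forall x, g x = p x + n x].

Lemma splits_homogeneous : splits -> homogeneous_graph G.
Proof.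
move=> split_G H [Hns _].
suff no_mix e f : e \in sub_edges H -> f \in sub_edges H ->
    positive_edge e -> ~~ positive_edge f -> False.
  move=> e f He Hf; case e_sgn: (positive_edge e); case f_sgn: (positive_edge f) => //.
    by case: (no_mix e f); rewrite ?e_sgn ?f_sgn.
  by case: (no_mix f e); rewrite ?e_sgn ?f_sgn.
move=> He Hf e_pos f_neg.
have [v /andP[]] := mixed_vertex Hns He Hf e_pos f_neg.
case/exists_inP=> {e_pos}e {}He /andP[/eqP e_pos /existsP[u evu]].
case/exists_inP=> {f_neg}f {}Hf /andP[/eqP f_neg /existsP[w fvw]].
(* The indicator of [v] is split; away from [v] this gives [p = - n], so [p] is constant along every
   edge of [H - v]. *)
have [p [n [p_pos n_neg pn]]] := split_G (fun x => (x == v)%:R).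
have /andP[Hv Hu] := links_in_subgraph He evu.
have /andP[_ Hw] := links_in_subgraph Hf fvw.
have uv : u != v by rewrite eq_sym (links_neq evu).
have wv : w != v by rewrite eq_sym (links_neq fvw).
have pn0 x : x != v -> p x = - n x.
  by move=> /negPf xv; apply/eqP; rewrite -addr_eq0 -pn xv.
have p_inv : invariant_fun (joins (sub_edges (delete_vertex H v))) p.
  apply: joins_invariant => g; rewrite inE => /and3P[_ g1 g2].
  by have [/p_pos // | /n_neg gn] := boolP (positive_edge g); rewrite !pn0 ?gn.
have puw : p u = p w.
  apply: (connect_invariant (invariant_sym p_inv)).
  by apply: nonseparable_delete_connected; rewrite // in_setD1 ?uv ?wv.
have pvu : p v = p u by apply: links_const evu; apply: p_pos; rewrite e_pos.
have nvw : n v = n w by apply: links_const fvw; apply: n_neg; rewrite f_neg.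
(* [p v + n v = p u + n w = p w + n w = 0], although the indicator of [v] is 1 at [v]. *)
have := pn v; rewrite eqxx pvu nvw puw (pn0 w wv) addNr.
by move/eqP; rewrite oner_eq0.
Qed.

(** * Cycles and blocks *)

Definition adjacent : rel (vertex G) := [rel u v | [exists e, links e u v]].

Lemma adjacentC : symmetric adjacent.
Proof. by move=> u v; apply: eq_existsb => e; apply: linksC. Qed.

Lemma path_connect (F : {set edge G}) (A : {set vertex G}) x s :
  (forall e, (ends e).1 \in A -> (ends e).2 \in A -> e \in F) ->
  path adjacent x s -> {subset x :: s <= A} ->
  {in x :: s &, forall u v, connect (sym_rel (joins F)) u v}.
Proof.
move=> FA xs sA.
suff cx : {in x :: s, forall y, connect (sym_rel (joins F)) x y}.
  move=> u v /cx xu /cx; apply: connect_trans; rewrite sym_connectC.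
  exact: xu.
elim: s x xs sA => [|z s IHs] x /= => [_ _ y | /andP[/existsP[e xz] zs] sA y].
  by rewrite inE => /eqP ->.
rewrite inE => /predU1P[-> // | sy].
have sA' : {subset z :: s <= A} by move=> t ts; apply: sA; rewrite inE ts orbT.
apply: connect_trans (IHs z zs sA' y sy); apply: connect1.
apply: (sym_joins _ xz); have Ax : x \in A by apply: sA; rewrite inE eqxx.
have Az : z \in A by apply: sA'; rewrite inE eqxx.
by apply: FA; case/orP: xz => /eqP ->.
Qed.

Definition induced_edges (A : {set vertex G}) : {set edge G} :=
  [set e | ((ends e).1 \in A) && ((ends e).2 \in A)].

Lemma induced_subproof (A : {set vertex G}) e :
  e \in induced_edges A -> ((ends e).1 \in A) && ((ends e).2 \in A).
Proof. by rewrite inE. Qed.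

Lemma links_induced (A : {set vertex G}) e u v :
  links e u v -> u \in A -> v \in A -> e \in induced_edges A.
Proof. by move=> + uA vA => /orP[] /eqP eE; rewrite inE eE uA vA. Qed.

Definition induced (A : {set vertex G}) : subgraph G :=
  Subgraph (@induced_subproof A).

(** A cycle without one vertex is a path, hence connected. Inducing avoids a choice of edges; chords
    and parallel edges cannot disconnect anything. *)
Lemma cycle_nonseparable x s :
  uniq (x :: s) -> cycle adjacent (x :: s) -> nonseparable (induced [set y in x :: s]).
Proof.
set A := [set y in x :: s] => s_uniq s_cycle.
have A1 : #|graph_components (induced A)| = 1%N.
  apply/eqP; rewrite eqn_leq; apply/andP; split.
    apply/card_components_le1 => u v; rewrite !inE => su sv.
    apply: (@path_connect _ A x s); rewrite ?inE //.
    - by move=> e e1 e2; rewrite inE e1 e2.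
    - by move: s_cycle; rewrite /= rcons_path => /andP[].
    by move=> y ys; rewrite inE.
  rewrite card_gt0; apply/set0Pn;
  exists (component (joins (sub_edges (induced A))) A x).
  by apply: imset_f; rewrite !inE eqxx.
split=> [// | z [Az]]; rewrite A1 ltnNge => /negP[].
have Az' : z \in x :: s by rewrite inE in Az.
have [i s' rot_s] := rot_to Az'.
apply/card_components_le1.
have [zs'_uniq zs'_cycle] : uniq (z :: s') /\ cycle adjacent (z :: s').
  by rewrite -rot_s rot_uniq rot_cycle.
have memA y : (y \in A) = (y \in z :: s') by rewrite inE -rot_s mem_rot.
have memAz y : (y \in A :\ z) = (y \in s').
  rewrite in_setD1 memA in_cons; case: eqP => //= ->.
  by case/andP: zs'_uniq => /negPf ->.
move=> u v; rewrite !memAz.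
case: s' {rot_s zs'_uniq memA} zs'_cycle memAz => // y s' /= /andP[_].
rewrite rcons_path => /andP[ys' _] memAz.
apply: (@path_connect _ (A :\ z) y s') => // [e | t ts]; last by rewrite memAz.
by rewrite !in_setD1 !inE => /andP[-> ->] /andP[-> ->].
Qed.

(** Induction on the number of missing vertices and edges: if [e] and [f] had different signs, the
    induction hypothesis would exclude any larger nonseparable subgraph, so [K] would be a block. *)
Lemma nonseparable_homogeneous K :
  homogeneous_graph G -> nonseparable K ->
  {in sub_edges K &, forall e f, positive_edge e = positive_edge f}.
Proof.
move=> hom; pose size_of K := (#|sub_vertices K| + #|sub_edges K|)%N.
have [m] := ubnP (#|vertex G| + #|edge G| - size_of K)%N.
elim: m K => // m IHm K; rewrite ltnS => leKm Kns e f Ke Kf.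
apply/eqP; apply: contraT => ef; case/eqP: (ef).
apply: (hom K) => //; split=> // K' K'ns [sV sE].
suff /andP[] : (sub_vertices K' \subset sub_vertices K) &&
               (sub_edges K' \subset sub_edges K).
  by [].
apply: contraT => nsub; case/eqP: ef; apply: (IHm K'); rewrite ?(subsetP sE) //.
have ltKK' : (size_of K < size_of K')%N.
  have leV := subset_leq_card sV; have leE := subset_leq_card sE.
  case/nandP: nsub => nsub; rewrite /size_of.
    by rewrite -addSn leq_add // proper_card // properE sV.
  by rewrite -addnS leq_add // proper_card // properE sE.
apply: leq_trans leKm; apply: ltn_sub2l => //.
by apply: leq_trans ltKK' _; rewrite leq_add ?max_card.
Qed.

(** * Splitting functions on a homogeneous graph *)

(** Adjacency in [G - v], kept on all vertices, with [v] isolated. *)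
Definition off v : rel (vertex G) :=
  [rel x y | [&& adjacent x y, x != v & y != v]].

(** A simple path from [x] to [y] in [G - v] closes up through [v] by [e] and [f]. If [x = y], the
    resulting cycle has two vertices, and the subgraph they induce still contains both edges. *)
Lemma off_connect_sign v x y e f :
  homogeneous_graph G -> connect (off v) x y -> links e v x -> links f v y ->
  positive_edge e = positive_edge f.
Proof.
move=> hom /connectP[s0 xs0 ->]; case/shortenP: xs0 => s xs s_uniq _ evx fvy.
have adj_s : path adjacent x s by apply: sub_path xs => a b /andP[].
have v_s : v \notin x :: s.
  rewrite in_cons (negPf (links_neq evx)) /=.
  elim: s x xs {s_uniq evx fvy adj_s} => //= z s IHs x /andP[/and3P[_ _ zv] /IHs].
  by rewrite in_cons eq_sym (negPf zv).
apply: (nonseparable_homogeneous hom (@cycle_nonseparable v (x :: s) _ _)).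
- by rewrite cons_uniq v_s.
- rewrite /= rcons_path adj_s /=; apply/andP; split; apply/existsP; first by exists e.
  by exists f; rewrite linksC.
- by apply: links_induced evx _ _; rewrite !inE eqxx ?orbT.
- by apply: links_induced fvy _ _; rewrite inE in_cons ?eqxx // mem_last orbT.
Qed.

Definition attached v x :=
  [exists y, connect (off v) x y && [exists e, positive_edge e && links e v y]].

Lemma off_connectC v : connect_sym (off v).
Proof.
suff offC x y : off v x y -> off v y x.
  by apply: sym_connect_sym => x y; apply/idP/idP; apply: offC.
by case/and3P=> xy xv yv; apply/and3P; split; rewrite // adjacentC.
Qed.

Lemma attached_off v x y : connect (off v) x y -> attached v x = attached v y.
Proof.
by move=> xy; apply: eq_existsb => z; rewrite (same_connect (@off_connectC v) xy).
Qed.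

Lemma homogeneous_splits : homogeneous_graph G -> splits.
Proof.
move=> hom g; pose P v x : rat := ((x == v) || attached v x)%:R.
have off_ends v e : (ends e).1 != v -> (ends e).2 != v ->
    P v (ends e).1 = P v (ends e).2.
  move=> e1 e2; rewrite /P (negPf e1) (negPf e2) (@attached_off _ _ (ends e).2) //.
  apply/connect1/and3P; split=> //.
  by apply/existsP; exists e; apply: links_ends.
have P_pos v e x : positive_edge e -> links e v x -> P v v = P v x.
  move=> e_pos evx; rewrite /P eqxx /=; suff -> : attached v x by rewrite orbT.
  by apply/existsP; exists x; rewrite connect0; apply/existsP; exists e; rewrite e_pos.
(* Across a negative edge at [v], [P v] drops by 1 just as the indicator of [v] does. *)
have N_neg v e x : ~~ positive_edge e -> links e v x -> P v v - 1 = P v x.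
  move=> e_neg evx; rewrite /P eqxx subrr eq_sym (negPf (links_neq evx)) /=.
  suff /negPf -> : ~~ attached v x by [].
  apply/existsP => -[y /andP[xy /existsP[f /andP[f_pos fvy]]]].
  by have := off_connect_sign hom xy evx fvy; rewrite (negPf e_neg) f_pos.
(* The splittings of the vertex indicators are combined linearly with weights [g v]. *)
exists (fun x => \sum_v g v * P v x), (fun x => \sum_v g v * ((v == x)%:R - P v x)).
split=> [e e_pos | e e_neg | x].
- apply: eq_bigr => v _; congr (_ * _).
  have [<- | e1] := eqVneq (ends e).1 v; first exact: P_pos (links_ends e).
  have [<- | e2] := eqVneq (ends e).2 v; last exact: off_ends.
  by apply/esym/(P_pos _ e); rewrite // linksC links_ends.
- apply: eq_bigr => v _; congr (_ * _).
  have [<- | e1] := eqVneq (ends e).1 v.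
    rewrite (negPf (loopless e)) -(N_neg _ _ _ e_neg (links_ends e)).
    by rewrite sub0r opprB.
  have [<- | e2] := eqVneq (ends e).2 v.
    rewrite -(N_neg (ends e).2 e (ends e).1) //.
      by rewrite sub0r opprB.
    by rewrite linksC links_ends.
  by rewrite off_ends.
rewrite -big_split /=; under eq_bigr do rewrite -mulrDr addrC subrK.
by rewrite sum_delta.
Qed.

End SignedGraph.

(** * Homogeneous diagrams *)

Section Homogeneity.

Variable D : knot_diagram.

(** Full smoothing already identifies the four arcs at a crossing in pairs, each with one incoming
    arc; a kept crossing also identifies the two pairs. *)
Lemma touch_invariantP (S : pred (crossing D)) (f : arc D -> rat) :
  invariant_fun (touch S) f <-> invariant_fun (@touch D predT) f /\
    forall x, ~~ S x -> f (inarc (x, true)) = f (inarc (x, false)).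
Proof.
have arcs_at_touch x a b : ~~ S x -> a \in arcs_at x -> b \in arcs_at x -> touch S a b.
  by move=> /negPf Sx ax bx; apply/existsP; exists x; rewrite Sx ax.
split=> [fS | [/touch_predT_invariantP fT fS]].
  split=> [|x Sx]; last first.
    by apply/fS/(arcs_at_touch x); rewrite // !inE eqxx ?orbT.
  apply/touch_predT_invariantP => x s; apply: fS.
  have [Sx | Sx] := boolP (S x).
    by apply/existsP; exists x; rewrite Sx; apply/existsP; exists s; rewrite !eqxx.
  by apply: (arcs_at_touch x) => //; case: s; rewrite !inE eqxx ?orbT.
move=> a b /existsP[x]; case: ifPn => [_ | /fS Sx].
  by case/existsP=> s /andP[/eqP<- /eqP<-].
suff fx c : c \in arcs_at x -> f c = f (inarc (x, true)).
  by case/andP=> /fx-> /fx->.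
by rewrite !inE -!orbA => /or4P[] /eqP->; rewrite // -(fT x false, fT x true).
Qed.

Lemma invariant_circle_fun (f : arc D -> rat) :
  invariant_fun (@touch D predT) f ->
  exists g : seifert_circle D -> rat, forall a, f a = g (circle_of a).
Proof.
move=> f_inv.
exists (fun c => if [pick a | circle_of a == c] is Some a then f a else 0).
move=> a; case: pickP => [b | /(_ a)]; last by rewrite eqxx.
rewrite circle_of_eq => ba; apply/esym.
exact: (connect_invariant (invariant_sym f_inv)).
Qed.

Lemma circle_of_surj (c : seifert_circle D) : exists a, circle_of a = c.
Proof.
by case: c => C HC; have /imsetP[a _ Ca] := HC; exists a; apply/val_inj.
Qed.

Lemma touch_circle_fun (S : pred (crossing D)) (g : seifert_circle D -> rat) :
  (forall x, ~~ S x ->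
     g (circle_of (inarc (x, true))) = g (circle_of (inarc (x, false)))) ->
  invariant_fun (touch S) (g \o @circle_of D).
Proof.
by move=> gS; apply/touch_invariantP; split=> // a b /circle_of_invariant /= ->.
Qed.

(** Functions on circles are the arc functions invariant under full smoothing. Smoothing only the
    negative crossings keeps the positive ones, which forces constancy along positive edges. *)
Lemma splits_seifert_graph :
  splits (seifert_graph D) <->
  (forall f : arc D -> rat, invariant_fun (@touch D predT) f ->
   exists p n : arc D -> rat,
     [/\ invariant_fun (touch (@negative D)) p,
         invariant_fun (touch (@positive D)) n & forall a, f a = p a + n a]).
Proof.
split=> [split_D f /invariant_circle_fun[g fg] | split_D g].
  have [p [n [p_pos n_neg pn]]] := split_D g.
  exists (p \o @circle_of D), (n \o @circle_of D).
  split=> [||a]; last by rewrite fg pn.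
    by apply: touch_circle_fun => x /negPn /p_pos.
  by apply: touch_circle_fun => x /n_neg.
have [|p [n [/touch_invariantP[p_inv p_pos] /touch_invariantP[n_inv n_neg] pn]]] :=
    split_D (g \o @circle_of D).
  by move=> a b /circle_of_invariant /= ->.
have [p' pp'] := invariant_circle_fun p_inv.
have [n' nn'] := invariant_circle_fun n_inv.
exists p', n'; split=> [x x_pos | x x_neg | c] /=.
- by rewrite -!pp' p_pos // negbK.
- by rewrite -!nn' n_neg.
- by have [a <-] := circle_of_surj c; rewrite -pp' -nn' -pn.
Qed.

Lemma Delta_eq0 : Delta D = 0 <-> (O_plus D + O_minus D = O_all D + 1)%N.
Proof.
rewrite /Delta -addrA -opprD -!PoszD; split=> [/eqP | ->]; last by rewrite subrr.
by rewrite subr_eq0 => /eqP[].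
Qed.

End Homogeneity.

Theorem theorem3p4 (D : knot_diagram) : homogeneous D <-> Delta D = 0%R.
Proof.
have loopless (x : edge (seifert_graph D)) : (ends x).1 != (ends x).2.
  exact: seifert_graph_loopless.
apply: (iff_trans (B := splits (seifert_graph D))).
  split; [exact: homogeneous_splits | exact: splits_homogeneous].
apply: (iff_trans (splits_seifert_graph D)); apply: iff_sym.
apply: (iff_trans (Delta_eq0 D)).
apply: card_components_split; last exact: arc_nonempty.
- by move=> f /touch_invariantP[].
- by move=> f /touch_invariantP[].
move=> f /touch_invariantP[/touch_predT_invariantP fT f_pos] /touch_invariantP[_ f_neg].
apply: arc_invariant_const => -[x s].
(* A function in both spaces agrees on all four arcs at a crossing, hence is constant along the
   single strand. *)
have fx : f (inarc (x, true)) = f (inarc (x, false)).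
  by have [/f_neg // | x_pos] := boolP (negative x); apply/f_pos.
by case: s; rewrite -?(fT x false) -?(fT x true) fx.
Qed.
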